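(* Let $\mathcal{E}$ be a finite-dimensional Euclidean space, let $\mathcal{X}$ and $\mathcal{Y}$ be $C^2$ embedded submanifolds of $\mathcal{E}$, and let $Z\in\mathcal{X}\cap\mathcal{Y}$. Then $\mathcal{X}$ and $\mathcal{Y}$ are intrinsically transversal at $Z$ if and only if they satisfy projection-based transversality at $Z$.
   Context: For a submanifold $\mathcal{S}\subseteq\mathcal{E}$ and $S\in\mathcal{S}$, $\mathrm{N}_{\mathcal{S}}(S)$ is the normal space (orthogonal complement of the tangent space $\mathrm{T}_{\mathcal{S}}(S)$); $\mathrm{dist}(y,\mathcal{C})=\inf_{x\in\mathcal{C}}\|x-y\|$; $\mathcal{P}_{\mathcal{S}}$ denotes the nearest-point projection onto $\mathcal{S}$ (single-valued near $Z$ for $C^2$ submanifolds). Intrinsic transversality at $Z\in\mathcal{X}\cap\mathcal{Y}$: there exist a constant $\kappa\in(0,1]$ and a neighborhood of $Z$ such that for all $X\in\mathcal{X}\setminus\mathcal{Y}$ and $Y\in\mathcal{Y}\setminus\mathcal{X}$ in this neighborhood, with $u=(X-Y)/\|X-Y\|$, $$\max\{\mathrm{dist}(u,\mathrm{N}_{\mathcal{Y}}(Y)),\ \mathrm{dist}(u,-\mathrm{N}_{\mathcal{X}}(X))\}\ge\kappa.$$ Projection-based transversality at $Z\in\mathcal{X}\cap\mathcal{Y}$: there exist a constant $\kappa'\in(0,1]$ and a neighborhood $\mathcal{B}$ of $Z$ such that, writing $u=(X-Y)/\|X-Y\|$, (i) for all $Y\in(\mathcal{Y}\cap\mathcal{B})\setminus\mathcal{X}$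 with $X=\mathcal{P}_{\mathcal{X}}(Y)$, one has $\mathrm{dist}(u,\mathrm{N}_{\mathcal{Y}}(Y))\ge\kappa'$; (ii) for all $X\in(\mathcal{X}\cap\mathcal{B})\setminus\mathcal{Y}$ with $Y=\mathcal{P}_{\mathcal{Y}}(X)$, one has $\mathrm{dist}(u,-\mathrm{N}_{\mathcal{X}}(X))\ge\kappa'$. *)

(* Defs.v *)
From HB Require Import structures.
From mathcomp Require Import all_boot all_order all_algebra.
From mathcomp Require Import sesquilinear.
From mathcomp Require Import all_classical all_reals all_analysis.

Set Implicit Arguments.
Unset Strict Implicit.
Unset Printing Implicit Defensive.

Import Order.TTheory GRing.Theory Num.Theory.
Import numFieldNormedType.Exports.

Local Open Scope classical_set_scope.
Local Open Scope ring_scope.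

Section Euclidean.
Context {R : realType} {E : normedModType R}.

(* The norm E already carries (which defines its topology) is the one induced by
   ip, and E is spanned by finitely many vectors. *)
Definition euclidean (ip : {dot E for idfun}) : Prop :=
  (forall x : E, `|x| = Num.sqrt (ip x x)) /\
  (exists (n : nat) (b : 'I_n -> E),
     forall x : E, exists a : 'I_n -> R, x = \sum_(i < n) a i *: b i).

Definition dist (y : E) (C : set E) : R := inf [set `|x - y| | x in C].

(* Set-valued; a singleton for y close to a point of a C^2 submanifold S. *)
Definition proj (S : set E) (y : E) : set E :=
  [set x | S x /\ `|x - y| = dist y S].

Definition unit_dir (x y : E) : E := `|x - y|^-1 *: (x - y).

Definition linear_subspace (F : set E) : Prop :=
  F 0 /\ forall (a : R) (x y : E), F x -> F y -> F (a *: x + y).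

End Euclidean.

(* Continuity of x |-> 'd f x is required pointwise, i.e. of x |-> 'd f x v for
   every v; on a finite-dimensional V this is the same as continuity in
   operator norm. *)
Fixpoint of_class_C {R : realType} {V W : normedModType R} (k : nat)
    (U : set V) (f : V -> W) : Prop :=
  match k with
  | 0%N => forall x, U x -> {for x, continuous f}
  | k'.+1 => (forall x, U x -> differentiable f x) /\
             (forall v, of_class_C k' U (fun x => 'd f x v))
  end.

Section Submanifold.
Context {R : realType} {E : normedModType R}.

(* phi is a C^k diffeomorphism from an open neighbourhood U of p onto an open
   set V, with inverse psi, straightening S to the linear subspace F. *)
Definition slice_chart (k : nat) (S F : set E) (p : E)
    (U V : set E) (phi psi : E -> E) : Prop :=
  [/\ open U, open V & U p] /\
  [/\ set_fun U V phi, set_fun V U psi,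
      {in U, cancel phi psi} & {in V, cancel psi phi}] /\
  [/\ of_class_C k U phi, of_class_C k V psi &
      S `&` U = phi @^-1` F `&` U].

(* One model subspace F serves all points, so that S has constant dimension. *)
Definition embedded_submanifold (k : nat) (S : set E) : Prop :=
  exists2 F : set E, linear_subspace F &
    forall p, S p -> exists U V phi psi, slice_chart k S F p U V phi psi.

(* Velocities at p of C^1 curves in S. *)
Definition tangent (S : set E) (p : E) : set E :=
  [set v | exists (c : R -> E) (e : R),
     [/\ 0 < e, of_class_C 1 (ball (0 : R) e) c,
         (forall t, ball (0 : R) e t -> S (c t)),
         c 0 = p & derive1 c 0 = v]].

Variable ip : {dot E for idfun}.

Definition normal (S : set E) (p : E) : set E :=
  [set n | forall v, tangent S p v -> ip n v = 0].

Definition intrinsically_transversal (X Y : set E) (z : E) : Prop :=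
  exists (kappa : R) (B : set E),
    [/\ 0 < kappa, kappa <= 1, nbhs z B &
      forall x y, (X `\` Y) x -> (Y `\` X) y -> B x -> B y ->
        let u := unit_dir x y in
        kappa <= Num.max (dist u (normal Y y)) (dist u (-%R @` normal X x))].

Definition projection_transversal (X Y : set E) (z : E) : Prop :=
  exists (kappa : R) (B : set E),
    [/\ [/\ 0 < kappa, kappa <= 1 & nbhs z B],
      (forall x y, ((Y `&` B) `\` X) y -> proj X y x ->
        kappa <= dist (unit_dir x y) (normal Y y)) &
      (forall x y, ((X `&` B) `\` Y) x -> proj Y x y ->
        kappa <= dist (unit_dir x y) (-%R @` normal X x))].

End Submanifold.

(* Main.v *)
Require Import Defs.
From mathcomp Require Import all_boot all_order all_algebra.
From mathcomp Require Import sesquilinear.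
From mathcomp Require Import all_classical all_reals all_analysis.
From mathcomp Require Import ring lra.

(* If x' is a nearest point of X to y, then x' - y is normal to X at x', so for
   the pair (x', y) the X-distance in intrinsic transversality vanishes and only
   the Y-distance remains: intrinsic transversality implies clause (i), except
   when x' lies in Y, and then x' - y is a short secant of Y and is far from
   being normal to Y.  Conversely, if (x - y)/|x - y| were close to both -N_X(x)
   and N_Y(y), then pairing the secant x' - x with itself shows that x' is so
   close to x, relative to |x - y|, that (x' - y)/|x' - y| is still close to
   N_Y(y), against clause (i); clause (ii) is not needed.
   Both directions rest on one fact about a C^1 submanifold S near a point:
   |<n, x - y>| <= delta |n| |x - y| for x, y in S and n normal to S at y. *)

Import Order.TTheory GRing.Theory Num.Theory.
Import numFieldNormedType.Exports.
Local Open Scope classical_set_scope.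
Local Open Scope ring_scope.

Set Implicit Arguments.
Unset Strict Implicit.
Unset Printing Implicit Defensive.

(** * Finite-dimensional inner product spaces *)

Section InnerProduct.
Context {R : realType} {E : normedModType R} {ip : {dot E for idfun}}.
Hypothesis hE : euclidean ip.
Implicit Types (x y z : E) (a : R).

Lemma ipC x y : ip x y = ip y x.
Proof. by rewrite (@hermC _ false idfun) expr0 mul1r. Qed.

Lemma ipDl z x y : ip (x + y) z = ip x z + ip y z.
Proof. exact: linearDl. Qed.
Lemma ipNl z x : ip (- x) z = - ip x z.
Proof. exact: linearNl. Qed.
Lemma ipZl z a x : ip (a *: x) z = a * ip x z.
Proof. exact: linearZl_LR. Qed.
Lemma ipBl z x y : ip (x - y) z = ip x z - ip y z.
Proof. by rewrite ipDl ipNl. Qed.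
Lemma ip0l z : ip 0 z = 0. Proof. exact: linear0l. Qed.
Lemma ipDr z x y : ip z (x + y) = ip z x + ip z y.
Proof. by rewrite !(ipC z) ipDl. Qed.
Lemma ipNr z x : ip z (- x) = - ip z x.
Proof. by rewrite !(ipC z) ipNl. Qed.
Lemma ipZr z a x : ip z (a *: x) = a * ip z x.
Proof. by rewrite !(ipC z) ipZl. Qed.
Lemma ipBr z x y : ip z (x - y) = ip z x - ip z y.
Proof. by rewrite ipDr ipNr. Qed.
Lemma ip_suml (I : Type) (r : seq I) (f : I -> E) z :
  ip (\sum_(i <- r) f i) z = \sum_(i <- r) ip (f i) z.
Proof. exact: linear_sumlz. Qed.

Lemma ip_ge0 x : 0 <= ip x x.
Proof.
have [->|x0] := eqVneq x 0; first by rewrite ip0l.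
exact/ltW/neq0_dnorm_gt0.
Qed.

Lemma ip_norm x : ip x x = `|x| ^+ 2.
Proof. by rewrite hE.1 sqr_sqrtr// ip_ge0. Qed.

Lemma cauchy_schwarz x y : `|ip x y| <= `|x| * `|y|.
Proof.
have [->|x0] := eqVneq x 0; first by rewrite ip0l !normr0 mul0r.
have nx : 0 < `|x| by rewrite normr_gt0.
(* This is the residual of projecting [y] on [x] with the denominator cleared. Its squared norm is
   |x|^2 (|x|^2 |y|^2 - <x, y>^2). *)
have := ip_ge0 (`|x| ^+ 2 *: y - ip x y *: x).
rewrite ipBl !ipBr !ipZl !ipZr !ip_norm (ipC y x) => h.
rewrite -(@ler_pXn2r _ 2)// ?nnegrE// ?mulr_ge0// real_normK ?num_real// exprMn.
rewrite -subr_ge0 -(pmulr_rge0 _ (exprn_gt0 2 nx)).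
by apply: le_trans h _; rewrite le_eqVlt; apply/orP; left; apply/eqP; ring.
Qed.

(** The family is a total function on [nat] with a separate length, so extending it by one vector
    changes one value and no index type. *)
Definition orthonormal_upto (t : nat -> E) (m : nat) :=
  forall i j, (i < m)%N -> (j < m)%N -> ip (t i) (t j) = (i == j)%:R.

Definition expansion (t : nat -> E) (m : nat) (x : E) : E :=
  \sum_(i < m) ip x (t i) *: t i.

(** Writing each t_i in the spanning vectors b_k factors the Gram matrix of t, which is the identity
    of size m, through dimension n. Hence m is at most n by rank. *)
Lemma orthonormal_bounded :
  exists n : nat, forall t m, orthonormal_upto t m -> (m <= n)%N.
Proof.
have [n [b hb]] := hE.2; exists n => t m ot.
have /choice[a ha] := fun i : 'I_m => hb (t i).
pose A := \matrix_(i < m, k < n) a i k.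
pose B := \matrix_(k < n, j < m) ip (b k) (t j).
have AB : A *m B = 1%:M.
  apply/matrixP => i j; rewrite !mxE -(val_eqE i j) -(ot _ _ (ltn_ord i) (ltn_ord j)).
  rewrite [in RHS](ha i) ip_suml; apply: eq_bigr => k _.
  by rewrite !mxE ipZl.
by rewrite -(mxrank1 R m) -AB; exact: mulmx_max_rank.
Qed.

Lemma expansion_residual_orthogonal t m x j : orthonormal_upto t m ->
  (j < m)%N -> ip (x - expansion t m x) (t j) = 0.
Proof.
move=> ot jm; rewrite ipBl ip_suml (bigD1 (Ordinal jm))//= big1 => [|i ij].
  by rewrite ipZl ot// eqxx mulr1 addr0 subrr.
by rewrite ipZl ot// -val_eqE /= in ij *; rewrite (negbTE ij) mulr0.
Qed.

(** Gram-Schmidt by contradiction: if no orthonormal family in [F] expanded all of [F], a normalized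
    residual would always extend it, giving families of every length against
    [orthonormal_bounded]. *)
Lemma subspace_orthonormal_basis (F : set E) : linear_subspace F ->
  exists t m, [/\ orthonormal_upto t m, forall i, (i < m)%N -> F (t i) &
    forall x, F x -> expansion t m x = x].
Proof.
move=> [F0 FP]; have [n hn] := orthonormal_bounded.
have FZ a x : F x -> F (a *: x) by move=> Fx; rewrite -[_ *: _]addr0; exact: FP.
apply: contrapT => nobasis.
have : forall k, exists t, orthonormal_upto t k /\ forall i, (i < k)%N -> F (t i).
  elim=> [|k [t [ot Ft]]]; first by exists (fun=> 0).
  have [x Fx xt] : exists2 x, F x & expansion t k x <> x.
    apply: contrapT => h; apply: nobasis; exists t, k; split=> // x Fx.
    by apply: contrapT => hx; apply: h; exists x.
  pose r := x - expansion t k x.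
  have r0 : r != 0 by rewrite subr_eq0 eq_sym; exact/eqP.
  have Fr : F r.
    rewrite /r addrC -scaleN1r; apply: (FP) => //.
    by rewrite /expansion; apply: big_ind => // [u v Fu Fv|i _];
       [rewrite -[u]scale1r; exact: FP|exact/FZ/Ft].
  pose e := `|r|^-1 *: r.
  have e1 : ip e e = 1.
    by rewrite ipZl ipZr ip_norm expr2 mulKf ?normr_eq0// mulVf ?normr_eq0.
  have et j : (j < k)%N -> ip e (t j) = 0.
    by move=> jk; rewrite ipZl expansion_residual_orthogonal// mulr0.
  exists (fun i => if i == k then e else t i); split=> [i j|i]; last first.
    by rewrite ltnS leq_eqVlt; case: eqP => [_ _|_ /= ik]; [exact: FZ|exact: Ft].
  rewrite !ltnS (leq_eqVlt i) (leq_eqVlt j).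
  case: (eqVneq i k) => [->|ik] /=; case: (eqVneq j k) => [->|jk] //=.
  - by move=> _; exact: et.
  - by move=> h _; rewrite ipC et// (negbTE ik).
  - exact: ot.
by move=> /(_ n.+1) [t [/hn]]; rewrite ltnn.
Qed.

Lemma ipl_continuous z : continuous (fun x : E => ip x z).
Proof.
move=> x; apply/cvgrPdist_le => /= e e0.
have d0 : 0 < e / (`|z| + 1) by rewrite divr_gt0// ltr_wpDl.
near=> y; rewrite -ipBl (le_trans (cauchy_schwarz _ _))//.
have : `|x - y| <= e / (`|z| + 1).
  near: y; apply/nbhs_normP; exists (e / (`|z| + 1)) => //= y /ltW.
  by [].
rewrite ler_pdivlMr; last by rewrite ltr_wpDl.
by apply: le_trans; rewrite ler_wpM2l// lerDl.
Unshelve. all: by end_near. Qed.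

Lemma expansion_continuous t m : continuous (expansion t m).
Proof.
have -> : expansion t m = \sum_(i < m) (fun x => ip x (t i) *: t i).
  by apply/funext => x; rewrite fct_sumE.
move=> x; elim/big_ind : _ => [|f g cf cg|i _]; first exact: cst_continuous.
  exact: continuousD.
by apply: cvgZr_tmp; exact: ipl_continuous.
Qed.

(** For an orthonormal basis of [F], the subspace is the zero set of the continuous map sending x to
    [expansion t m x - x]. *)
Lemma linear_subspace_closed (F : set E) : linear_subspace F -> closed F.
Proof.
move=> hF; have [t [m [ot Ft tF]]] := subspace_orthonormal_basis hF.
have FZ a x : F x -> F (a *: x).
  by move=> Fx; rewrite -[_ *: _]addr0; apply: hF.2 => //; exact: hF.1.
have -> : F = (fun x => expansion t m x - x) @^-1` [set 0].
  apply/seteqP; split=> x /=; first by move=> /tF ->; rewrite subrr.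
  move/subr0_eq => <-; rewrite /expansion.
  apply: big_ind => [|u v Fu Fv|i _]; first exact: hF.1.
    by rewrite -[u]scale1r; exact: hF.2.
  exact/FZ/Ft.
apply: preimage_closed; last first.
  exact/accessible_closed_set1/hausdorff_accessible/norm_hausdorff.
by move=> x _; apply: cvgB => //; exact: expansion_continuous.
Qed.

(** Orthonormality of the [e i] gives the bound on coefficients through Cauchy-Schwarz. That bound
    yields both compactness of balls and operator norm estimates. *)
Lemma coordinates : exists (n : nat) (e : 'I_n -> E), forall x,
  exists a : 'I_n -> R, x = \sum_(i < n) a i *: e i /\ forall i, `|a i| <= `|x|.
Proof.
have [//|t [m [ot _ tE]]] := @subspace_orthonormal_basis setT.
exists m, (fun i => t i) => x; exists (fun i => ip x (t i)); split.
  by rewrite -[LHS](tE x).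
move=> i; rewrite (le_trans (cauchy_schwarz _ _))//.
by rewrite hE.1 hE.1 (ot i i)// eqxx sqrtr1 mulr1.
Qed.

(** The ball is a closed subset of the continuous image of the cube [-r, r]^n under the coordinate
    map. *)
Lemma closed_ball_compact z (r : R) : compact [set x : E | `|x - z| <= r].
Proof.
have [n [e he]] := coordinates.
pose f (a : 'rV[R]_n) : E := z + \sum_(i < n) a 0 i *: e i.
have cf : continuous f.
  have -> : f = cst z + \sum_(i < n) (fun a : 'rV[R]_n => a 0 i *: e i).
    by apply/funext => a; rewrite /f fctE fct_sumE.
  move=> a; apply: continuousD; first exact: cst_continuous.
  elim/big_ind : _ => [|g h cg ch|i _]; first exact: cst_continuous.
    exact: continuousD.
  exact: cvgZr_tmp (@coord_continuous R 1 n 0 i a).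
pose K := [set a : 'rV[R]_n | forall i, `[- r, r]%classic (a 0 i)].
have cK : compact K.
  by apply: (@rV_compact R n (fun=> `[- r, r]%classic)) => _; exact: segment_compact.
apply: (@subclosed_compact _ _ (f @` K)).
- apply: (@closed_comp _ _ (fun x => `|x - z|) [set s | s <= r]); last exact: closed_le.
  move=> x _; apply: cvg_norm; apply: cvgB => //; exact: cvg_cst.
- by apply: continuous_compact => //; exact: continuous_subspaceT.
- move=> x /= xr; have [a [ax ha]] := he (x - z).
  exists (\row_i a i) => [i|]; last first.
    rewrite /f -[RHS](subrK z) addrC ax; congr (_ + _).
    by apply: eq_bigr => i _; rewrite mxE.
  by rewrite mxE /= in_itv /= -ler_norml (le_trans (ha i)).
Qed.

End InnerProduct.

(** * Strict differentiability of C^1 maps *)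

Section Calculus.
Context {R : realType} {E : normedModType R} {ip : {dot E for idfun}}.
Hypothesis hE : euclidean ip.
Implicit Types (x y z : E) (a : R).

Lemma is_diff_line_comp (f : E -> E) y d (t : R) :
  differentiable f (y + t *: d) ->
  is_diff t (fun s : R => f (y + s *: d)) (fun s => s *: 'd f (y + t *: d) d).
Proof.
move=> df.
have dl : is_diff t (fun s : R => y + s *: d) (fun s => s *: d).
  have -> : (fun s : R => s *: d) = cst 0 + ( *:%R^~ d).
    by apply/funext => s /=; rewrite fctE /= add0r.
  exact: is_diffD.
have df' := differentiableP df.
apply: (is_diff_eq (is_diff_comp dl df')).
by apply/funext => s; exact: linearZ.
Qed.

Lemma is_derive_ipl (g : R -> E) (t : R) v w :
  is_derive t 1 g v -> is_derive t 1 (fun s => ip (g s) w) (ip v w).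
Proof.
move=> [dg gv].
have {gv}dg : h^-1 *: ((g \o shift t) (h *: (1 : R)) - g t) @[h --> 0^'] --> v.
  by rewrite -gv; exact: dg.
have cg := cvg_comp _ (fun x : E => ip x w) dg (@ipl_continuous _ _ _ hE w v).
have cg' : h^-1 *: (((fun s => ip (g s) w) \o shift t) (h *: (1 : R)) - ip (g t) w)
    @[h --> 0^'] --> ip v w.
  by apply: cvg_trans cg; apply: near_eq_cvg; near=> h; rewrite /= ipZl ipBl.
by apply: DeriveDef; [apply: cvgP cg'|apply: cvg_lim cg'].
Unshelve. all: by end_near. Qed.

(** Upgrades the pointwise continuity of the differential in [of_class_C] to operator norm: it
    suffices to control finitely many vectors [e i], since coefficients are bounded by |v|. *)
Lemma diff_continuous_opnorm (U : set E) (f : E -> E) p (eps : R) :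
  U p -> of_class_C 1 U f -> 0 < eps ->
  \forall x \near p, forall v, `|'d f x v - 'd f p v| <= eps * `|v|.
Proof.
move=> Up [_ cdf] eps0; have [n [e he]] := coordinates hE.
(* The n errors share [eps] equally; n + 1 keeps the denominator positive in dimension zero. *)
have n0 : 0 < n%:R + 1 :> R by rewrite ltr_wpDl.
have ne : \forall x \near p, forall i : 'I_n,
    `|'d f p (e i) - 'd f x (e i)| <= eps / (n%:R + 1).
  apply: filter_forall => i; have /cvgrPdist_le := cdf (e i) p Up.
  by apply; rewrite divr_gt0.
apply: filterS ne => x hx v; have [a [-> ha]] := he v.
rewrite distrC (linear_sum ('d f p)) (linear_sum ('d f x)) -sumrB.
rewrite (le_trans (ler_norm_sum _ _ _))//=.
set x0 := \sum_(i < n) a i *: e i in ha *.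
apply: (@le_trans _ _ (\sum_(i < n) `|x0| * (eps / (n%:R + 1)))).
  apply: ler_sum => i _; rewrite (linearZZ ('d f p)) (linearZZ ('d f x)) -scalerBr normrZ.
  by rewrite ler_pM.
rewrite sumr_const card_ord -mulrnAr [leRHS]mulrC ler_wpM2l//.
by rewrite -[_ *+ n]mulr_natr mulrAC ler_pdivrMr// ler_pM2l// lerDl.
Qed.

(** The mean value theorem is scalar, so f along the segment is paired with the error vector [w]
    itself. This gives |w|^2 = <(df_q - df_p)(x - y), w> for some q on the segment; Cauchy-Schwarz
    then allows division by |w|. *)
Lemma C1_strict_diff (U : set E) (f : E -> E) p (eps : R) :
  open U -> U p -> of_class_C 1 U f -> 0 < eps ->
  exists2 r, 0 < r & forall x y, ball p r x -> ball p r y ->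
    `|f x - f y - 'd f p (x - y)| <= eps * `|x - y|.
Proof.
move=> oU Up fC1 eps0.
have : nbhs p (U `&` [set x | forall v, `|'d f x v - 'd f p v| <= eps * `|v|]).
  apply: filterI; first exact: open_nbhs_nbhs.
  exact: diff_continuous_opnorm Up fC1 eps0.
move=> /nbhs_ballP[r /= r0 hr]; exists r => // x y px py.
set w := _ - 'd f p _.
have segm (t : R) : t \in `[0, 1] -> ball p r (y + t *: (x - y)).
  rewrite in_itv /= => /andP[t0 t1]; move: px py; rewrite -ball_normE /= => px py.
  have -> : p - (y + t *: (x - y)) = (1 - t) *: (p - y) + t *: (p - x).
    rewrite scalerBl scale1r addrAC -addrA -scalerBr.
    have -> : p - x - (p - y) = - (x - y) by rewrite !opprB addrC addrA subrK.
    by rewrite scalerN opprD addrA.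
  have [->|tn0] := eqVneq t 0; first by rewrite subr0 scale1r scale0r addr0.
  rewrite (le_lt_trans (ler_normD _ _))// !normrZ !ger0_norm ?subr_ge0//.
  rewrite [ltRHS](_ : _ = (1 - t) * r + t * r); last by ring.
  rewrite ler_ltD//.
    by rewrite ler_wpM2l ?subr_ge0// ltW.
  by rewrite ltr_pM2l// lt_def tn0.
pose h (t : R) := ip (f (y + t *: (x - y))) w.
pose dh (t : R) := ip ('d f (y + t *: (x - y)) (x - y)) w.
have hd (t : R) : t \in `[0, 1] -> is_derive t 1 h (dh t).
  move=> /segm/hr[/= Ut _]; apply: is_derive_ipl.
  have [ds Eds] := is_diff_line_comp (fC1.1 _ Ut).
  by apply: DeriveDef; [exact: diff_derivable|rewrite deriveE// Eds scale1r].
have hd' (t : R) : t \in `]0, 1[ -> is_derive t 1 h (dh t).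
  by move=> t01; apply: hd; exact: subset_itv_oo_cc.
have hc : {within `[0, 1], continuous h}.
  by apply: derivable_within_continuous => t t01; have [] := hd t t01.
have [t t01 Eh] := @MVT R h dh 0 1 ltr01 hd' hc.
have {}t01 : t \in `[0, 1] by apply: subset_itv_oo_cc.
have [/= _ /(_ (x - y)) hdf] := hr _ (segm t t01).
have ww : `|w| ^+ 2 = ip ('d f (y + t *: (x - y)) (x - y) - 'd f p (x - y)) w.
  move: Eh; rewrite /h /dh subr0 mulr1 scale1r scale0r addr0 [y + _]addrC subrK => Eh.
  by rewrite -(ip_norm hE) {1}/w ipBl ipBl Eh ipBl.
have [->|w0] := eqVneq w 0; first by rewrite normr0 mulr_ge0// ltW.
rewrite -(@ler_pM2r _ `|w|) ?normr_gt0// -expr2 ww.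
apply: le_trans (ler_norm _) _; apply: le_trans (cauchy_schwarz hE _ _) _.
by rewrite ler_wpM2r.
Qed.
End Calculus.

(** * Distances, tangents and normals *)

Section Distance.
Context {R : realType} {E : normedModType R}.
Implicit Types (x y u : E) (C S : set E).

Let dist_set_lb y C : lbound [set `|x - y| | x in C] 0.
Proof. by move=> _ [x _ <-]. Qed.

Lemma dist_le y C x : C x -> dist y C <= `|x - y|.
Proof.
move=> Cx; apply: ge_inf; first by exists 0; exact: dist_set_lb.
by exists x.
Qed.

(** Nonemptiness guards against the convention that the infimum of the empty set is 0. *)
Lemma le_dist y C k : C !=set0 -> (forall x, C x -> k <= `|x - y|) -> k <= dist y C.
Proof.
move=> [x Cx] h; apply: lb_le_inf; first by exists `|x - y|, x.
by move=> _ [z Cz <-]; exact: h.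
Qed.

Lemma dist_lt y C k : C !=set0 -> dist y C < k -> exists2 x, C x & `|x - y| < k.
Proof.
move=> [x0 Cx0] ltk.
have [|_ [x Cx <-] xk] := inf_lt _ ltk; first by exists `|x0 - y|, x0.
by exists x.
Qed.

Lemma proj_min C y x z : Defs.proj C y x -> C z -> `|x - y| <= `|z - y|.
Proof. by move=> [_ ->]; exact: dist_le. Qed.

Lemma unit_dirN x y : unit_dir y x = - unit_dir x y.
Proof. by rewrite /unit_dir distrC -scalerN opprB. Qed.

Lemma dist_opp u C : dist (- u) (-%R @` C) = dist u C.
Proof.
rewrite /dist; congr (inf _); apply/seteqP; split=> r /= [].
  by move=> _ [x Cx <-] <-; exists x => //; rewrite -opprD normrN.
by move=> x Cx <-; exists (- x); [exists x|rewrite -opprD normrN].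
Qed.

End Distance.

Lemma of_class_CW {R : realType} {V W : normedModType R} k (U : set V) (f : V -> W) :
  of_class_C k.+1 U f -> of_class_C k U f.
Proof.
elim: k f => [f [df _] x Ux|k IH f [df cdf]].
  exact/differentiable_continuous/df.
by split=> // v; apply: IH; exact: cdf.
Qed.

(** * Submanifolds: first-order optimality, secants and existence of nearest points *)

Section Submanifolds.
Context {R : realType} {E : normedModType R} {ip : {dot E for idfun}}.
Hypothesis hE : euclidean ip.
Implicit Types (x y z p : E) (a : R) (S : set E).

Lemma normal0 S p : normal ip S p 0.
Proof. by move=> v _; rewrite ip0l. Qed.

Lemma normalZ S p a n : normal ip S p n -> normal ip S p (a *: n).
Proof. by move=> h v /h nv; rewrite ipZl nv mulr0. Qed.

(** First-order optimality: along a curve in [S] through x, the squared distance to y is minimal at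
    time 0, so its derivative there vanishes. *)
Lemma nearest_point_normal S y x : Defs.proj S y x -> normal ip S x (x - y).
Proof.
move=> hx v [c [e [e0 [dc _] Sc c0 <-]]].
have dc0 : differentiable c 0 by apply: dc; exact: ballxx.
have Dc : is_derive (0 : R) 1 c (derive1 c 0).
  by apply: DeriveDef; [exact: diff_derivable|rewrite derive1E].
set v' := derive1 c 0 in Dc *.
pose s (h : R) := h^-1 *: (c h - x).
have sv : s h @[h --> 0^'] --> v'.
  have [dv <-] := Dc; apply: cvg_trans dv; apply: near_eq_cvg; near=> h.
  by rewrite /s /= addr0 c0 [h *: _]mulr1.
(* For nonzero h, h q(h) = |c(h) - y|^2 - |x - y|^2, which is nonnegative for small h. So q is
   nonpositive to the left of 0 and nonnegative to the right, and its limit is 0. *)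
pose q (h : R) := 2 * ip (s h) (x - y) + h * `|s h| ^+ 2.
have qv : q h @[h --> 0^'] --> 2 * ip v' (x - y).
  rewrite [X in _ --> X](_ : _ = 2 * ip v' (x - y) + 0 * `|v'| ^+ 2); last first.
    by rewrite mul0r addr0.
  apply: cvgD.
    apply: cvgM; first exact: cvg_cst.
    exact: (cvg_comp _ (fun z => ip z (x - y)) sv (@ipl_continuous _ _ _ hE _ v')).
  apply: cvgM; first by apply: nbhs_dnbhs.
  by rewrite expr2; apply: cvgM; exact: cvg_norm.
have hq h : h != 0 -> `|h| < e -> 0 <= h * q h.
  move=> h0 he; have Sch : S (c h) by apply: Sc; rewrite /ball /= sub0r normrN.
  have := proj_min hx Sch.
  have -> : c h - y = h *: s h + (x - y).
    by rewrite scalerA divff// scale1r addrA subrK.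
  rewrite -(@ler_pXn2r _ 2)// ?nnegrE// -!(ip_norm hE).
  rewrite /q -(ip_norm hE); move: (x - y) (s h) => w u.
  rewrite [leRHS]ipDl !ipDr !ipZl !ipZr (ipC w u) => hle.
  lra.
have L0 : 2 * ip v' (x - y) = 0.
  apply/eqP; rewrite eq_le; apply/andP; split.
    apply: (cvgr_to_le (F := (0 : R)^'-) (f := q)).
      move=> A /qv /nbhs_ballP[r r0 hA]; exists r => //= h hr h0.
      by apply: hA; rewrite //= lt_eqF.
    near=> h; have h0 : h < 0 by near: h; exact: nbhs_left_lt.
    rewrite -(nmulr_rge0 _ h0) hq ?lt_eqF// ltr0_norm//.
    rewrite ltrNl; near: h; apply: nbhs_left_gt; lra.
  apply: (cvgr_to_ge (F := (0 : R)^'+) (f := q)).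
    move=> A /qv /nbhs_ballP[r r0 hA]; exists r => //= h hr h0.
    by apply: hA; rewrite //= gt_eqF.
  near=> h; have h0 : 0 < h by near: h; exact: nbhs_right_gt.
  rewrite -(pmulr_rge0 _ h0) hq ?gt_eqF// gtr0_norm//.
rewrite ipC; lra.
Unshelve. all: by end_near. Qed.

(** The curve is the image under [psi] of the line t -> b + t d, which stays in [F], and in [V] for
    small t. *)
Lemma chart_tangent S F p U V phi psi (b d : E) :
  linear_subspace F -> slice_chart 1 S F p U V phi psi ->
  V b -> F b -> F d -> tangent S (psi b) ('d psi b d).
Proof.
move=> [_ FP] [[_ oV _] [[_ psiU _ psiK] [_ [dpsi cpsi] SU]]] Vb Fb Fd.
have line_cvg (t : R) : b + s *: d @[s --> t] --> b + t *: d.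
  by apply: cvgD; [exact: cvg_cst|apply: cvgZr_tmp].
have : \forall t \near (0 : R), V (b + t *: d).
  have /(_ V) := line_cvg 0; apply; rewrite scale0r addr0.
  exact: open_nbhs_nbhs.
move=> /nbhs_ballP[e /= e0 he].
have [c cE] : exists c : R -> E, c = fun t => psi (b + t *: d) by eexists.
have dc (t : R) : ball 0 e t -> is_diff t c (fun s => s *: 'd psi (b + t *: d) d).
  by move=> /he Vt; rewrite cE; apply: is_diff_line_comp; exact: dpsi.
have dcE (t v : R) : ball 0 e t -> 'd c t v = v *: 'd psi (b + t *: d) d.
  by move=> /dc[_ /(congr1 (fun g => g v))].
have cdc (v t : R) : ball 0 e t -> 'd c s v @[s --> t] --> 'd c t v.
  move=> te; have te' : \forall s \near t, ball (0 : R) e s.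
    by apply: open_nbhs_nbhs; split=> //; exact: ball_open.
  have h : v *: 'd psi (b + s *: d) d @[s --> t] --> 'd c t v.
    rewrite dcE//; apply: cvgZl_tmp.
    apply: (cvg_comp _ (fun x => 'd psi x d) (line_cvg t)).
    exact/cpsi/he.
  apply: cvg_trans h; apply: near_eq_cvg; near=> s; rewrite dcE//.
  by near: s; exact: te'.
exists c, e; split; first exact: e0.
- by split=> [t /dc[]//|v t te]; exact: cdc.
- move=> t /he Vt; have : (S `&` U) (c t); last by case.
  rewrite SU cE; split; last exact: psiU.
  by rewrite /= psiK ?inE// addrC; exact: FP.
- by rewrite cE scale0r addr0.
- have [dd Ed] := dc 0 (ballxx _ e0).
  by rewrite derive1E' // Ed scale0r addr0 scale1r.
Unshelve. all: by end_near. Qed.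

(** In a chart, the vector t = dpsi_{phi y}(phi x - phi y) is tangent at y, so n annihilates it, and
    x - y differs from t by a small multiple of |x - y|. *)
Lemma normal_almost_orthogonal_secant S p (delta : R) :
  embedded_submanifold 2 S -> S p -> 0 < delta ->
  exists2 r, 0 < r & forall x y n, S x -> S y -> ball p r x -> ball p r y ->
    normal ip S y n -> `|ip n (x - y)| <= delta * `|n| * `|x - y|.
Proof.
move=> [F hF hS] Sp d0; have [U [V [phi [psi hc]]]] := hS p Sp.
have {hS hc} [[oU oV Up] [[phiV psiU phiK psiK] [phiC2 psiC2 SU]]] := hc.
have phiC := of_class_CW phiC2; have psiC := of_class_CW psiC2.
have hc : slice_chart 1 S F p U V phi psi by split.
have Vq : V (phi p) by exact: phiV.
have [L1 L10 hL1] : exists2 k, k > 0 & forall v, `|'d phi p v| <= k * `|v|.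
  exact/linear_lipschitz/diff_continuous/phiC.1.
(* Lipschitz constant of [phi] near p: [L1] bounds its differential at p, and 1 is the error in
   strict differentiability. *)
pose L := L1 + 1; have L0 : 0 < L by rewrite addr_gt0.
have [r1 r10 hr1] := C1_strict_diff hE oU Up phiC ltr01.
have philip x y : ball p r1 x -> ball p r1 y -> `|phi x - phi y| <= L * `|x - y|.
  move=> xr yr; rewrite -[X in `|X|](subrK ('d phi p (x - y))).
  rewrite (le_trans (ler_normD _ _))// [leRHS]mulrDl addrC.
  by apply: lerD; [exact: hL1|exact: hr1].
(* Two errors of size eps |phi x - phi y| arise: one linearizes [psi] at [phi p], the other moves
   its differential from [phi p] to [phi y]. Their sum is at most 2 eps L |x - y| = delta |x -
   y|. *)
pose eps := delta / (2 * L).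
have eps0 : 0 < eps by rewrite divr_gt0// mulr_gt0.
have [r2 r20 hr2] := C1_strict_diff hE oV Vq psiC eps0.
have hop := diff_continuous_opnorm hE Vq psiC eps0.
have cphi : phi x @[x --> p] --> phi p.
  exact/differentiable_continuous/phiC.1.
have : nbhs p (U `&` ball p r1 `&` phi @^-1` (ball (phi p) r2 `&`
    [set b | forall v, `|'d psi b v - 'd psi (phi p) v| <= eps * `|v|])).
  apply: filterI; first by apply: filterI; [exact: open_nbhs_nbhs|exact: nbhsx_ballx].
  by apply: cphi; apply: filterI; [exact: nbhsx_ballx|exact: hop].
move=> /nbhs_ballP[r /= r0 hr]; exists r => // x y n Sx Sy /hr[[Ux xr1] [xr2 _]].
move=> /hr[[Uy yr1] [yr2 yop]] hn.
have chartF z : S z -> U z -> F (phi z).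
  by move=> Sz Uz; have : (S `&` U) z by []; rewrite SU => -[].
have Fd : F (phi x - phi y).
  by rewrite addrC -scaleN1r; apply: hF.2; exact: chartF.
have := chart_tangent hF hc (phiV _ Uy) (chartF _ Sy Uy) Fd.
rewrite phiK ?inE// => /hn; set t := 'd psi _ _ => nt.
have -> : ip n (x - y) = ip n (x - y - t) by rewrite [RHS]ipBr nt subr0.
rewrite (le_trans (cauchy_schwarz hE _ _))// mulrAC mulrC ler_wpM2r//.
have dxy := philip _ _ xr1 yr1.
have -> : x - y - t = (psi (phi x) - psi (phi y) - 'd psi (phi p) (phi x - phi y))
    - (t - 'd psi (phi p) (phi x - phi y)).
  by rewrite !phiK ?inE// opprB addrA subrK.
rewrite (le_trans (ler_normB _ _))//.
apply: (le_trans (lerD (hr2 _ _ xr2 yr2) (yop _))).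
rewrite -mulr2n -mulr_natl mulrA.
have -> : delta * `|x - y| = 2 * eps * (L * `|x - y|).
  by rewrite /eps; field; rewrite gt_eqF.
by rewrite ler_wpM2l// mulr_ge0// ltW.
Qed.

(** [S] may fail to be closed, but it is relatively closed in a chart domain because [F] is closed.
    Its trace on a small closed ball [C] is thus compact and contains a point of [S] closest to
    y. *)
Lemma proj_nonempty k S p : embedded_submanifold k.+1 S -> S p ->
  exists2 r, 0 < r & forall y, ball p r y -> Defs.proj S y !=set0.
Proof.
move=> [F hF hS] Sp; have [U [V [phi [psi]]]] := hS p Sp.
move=> [[oU _ Up] [_ [[dphi _] _ SU]]].
have /nbhs_ballP[r /= r0 hr] : nbhs p U by exact: open_nbhs_nbhs.
pose C := [set x | `|x - p| <= r / 2].
have CU : C `<=` U.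
  by move=> x xr; apply: hr; rewrite -ball_normE /= distrC (le_lt_trans xr)//; lra.
have cC : compact C := @closed_ball_compact _ _ _ hE p (r / 2).
have clC : closed C := compact_closed (@norm_hausdorff _ E) cC.
have SC x : C x -> S x <-> F (phi x).
  move=> Cx; have Ux := CU _ Cx; split=> [Sx|Fx].
    by have : (S `&` U) x by []; rewrite SU => -[].
  have : (phi @^-1` F `&` U) x by [].
  by rewrite -SU => -[].
have cK : compact (C `&` S).
  apply: (subclosed_compact _ cC); last exact: subIsetl.
  move=> x clx; have Cx : C x by apply: clC; apply: closureS clx; exact: subIsetl.
  split=> //; apply/(SC _ Cx); apply: (linear_subspace_closed hE hF) => A phixA.
  have /(_ _ phixA) := differentiable_continuous (dphi _ (CU _ Cx)).
  move=> /clx[z [[Cz Sz] Az]]; exists (phi z); split=> //.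
  exact/(SC _ Cz).
(* A point of [S] outside [C] is at distance more than r/2 - r/4 from y, hence farther than p, which
   belongs to [C]. *)
exists (r / 4) => [|y yr]; first lra.
have Cp : C p by rewrite /C /= subrr normr0; lra.
have [||x /set_mem[Cx Sx] xmin] :=
    @compact_EVT_min E R (fun x => `|x - y|) (C `&` S) _ cK.
- by exists p.
- apply: continuous_subspaceT => x; apply: cvg_norm; apply: cvgB => //.
  exact: cvg_cst.
exists x; split=> //; apply/eqP; rewrite eq_le; apply/andP; split; last exact: dist_le.
apply: le_dist => [|z Sz]; first by exists p.
have [Cz|] := lerP `|z - p| (r / 2); first by apply: xmin; exact/mem_set.
move=> zr; apply: (@le_trans _ _ `|p - y|); first by apply: xmin; exact/mem_set.
have : `|z - p| <= `|z - y| + `|y - p|.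
  by rewrite -[X in `|X| <= _](subrKA y) ler_normD.
move: yr; rewrite -ball_normE /= distrC => yr; lra.
Qed.

End Submanifolds.

(** * Transversality *)

Section Transversality.
Context {R : realType} {E : normedModType R} {ip : {dot E for idfun}}.
Hypothesis hE : euclidean ip.
Implicit Types (x y z p : E) (a : R) (S X Y : set E).

(* Clause (i) of projection-based transversality; clause (ii) is clause (i) with
   X and Y exchanged, because dist (-u) (-N) = dist u N. *)
Definition half_projection_transversal X Y (kappa : R) (B : set E) :=
  forall x y, ((Y `&` B) `\` X) y -> Defs.proj X y x ->
    kappa <= dist (unit_dir x y) (normal ip Y y).

Lemma projection_transversalP X Y Z :
  projection_transversal ip X Y Z <->
  (exists kappa B,
    [/\ 0 < kappa <= 1, nbhs Z B & half_projection_transversal X Y kappa B]) /\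
  (exists kappa B,
    [/\ 0 < kappa <= 1, nbhs Z B & half_projection_transversal Y X kappa B]).
Proof.
split=> [[k [B [[k0 k1 ZB] h1 h2]]]|].
  split; exists k, B; split; rewrite ?k0//.
  by move=> y x hx hy; rewrite unit_dirN -dist_opp opprK; exact: h2.
move=> [[k1 [B1 [/andP[k10 k11] ZB1 h1]]] [k2 [B2 [/andP[k20 k21] ZB2 h2]]]].
exists (Num.min k1 k2), (B1 `&` B2); split.
- by split; [rewrite lt_min k10|rewrite ge_min k11|exact: filterI].
- move=> x y [[Yy [By _]] Xy] hx; apply: (@le_trans _ _ k1).
    by rewrite ge_min lexx.
  by apply: h1.
- move=> x y [[Xx [_ Bx]] Yx] hy; apply: (@le_trans _ _ k2).
    by rewrite ge_min lexx orbT.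
  by rewrite unit_dirN dist_opp; apply: h2.
Qed.

(** Exchanging the sets reverses u; moving the sign onto the cones swaps the two terms of the
    maximum. *)
Lemma intrinsically_transversalC X Y Z :
  intrinsically_transversal ip X Y Z -> intrinsically_transversal ip Y X Z.
Proof.
move=> [k [B [k0 k1 ZB h]]]; exists k, B; split=> // y x hy hx By Bx /=.
rewrite (unit_dirN x y) dist_opp maxC -[dist (- _) _]dist_opp opprK.
exact: h.
Qed.

Lemma norm_unit_dir x y : x != y -> `|unit_dir x y| = 1.
Proof.
move=> xy; rewrite normrZ normfV normr_id mulVf//.
by rewrite normr_eq0 subr_eq0.
Qed.

(** Since z itself competes with x, |x - y| is at most |z - y|, so projecting at most doubles the
    distance to z. *)
Lemma proj_near S y x z r : Defs.proj S y x -> S z -> ball z (r / 2) y -> ball z r x.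
Proof.
move=> hx Sz; rewrite -ball_normE /= => zy.
have := proj_min hx Sz; have : `|z - x| <= `|z - y| + `|y - x|.
  by rewrite -[X in `|X| <= _](subrKA y) ler_normD.
rewrite (distrC y); lra.
Qed.

Lemma intrinsic_half_projection X Y Z :
  embedded_submanifold 2 Y -> (X `&` Y) Z -> intrinsically_transversal ip X Y Z ->
  exists kappa B, [/\ 0 < kappa <= 1, nbhs Z B & half_projection_transversal X Y kappa B].
Proof.
move=> hY [XZ YZ] [k [B [k0 k1 /nbhs_ballP[r1 /= r10 hr1] hIT]]].
have half0 : 0 < 2^-1 :> R by rewrite invr_gt0.
have [r2 r20 hr2] := normal_almost_orthogonal_secant hE hY YZ half0.
pose r := Num.min r1 r2; have r0 : 0 < r by rewrite lt_min r10.
have subr x : ball Z r x -> ball Z r1 x /\ ball Z r2 x.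
  by split; apply: le_ball H; rewrite /r ge_min lexx ?orbT.
(* The bound [k] serves when x lies outside [Y], and 1/2 when x lies in [Y]. *)
exists (Num.min k 2^-1), (ball Z (r / 2)); split.
- by rewrite lt_min k0 half0 ge_min k1.
- by apply: nbhsx_ballx; rewrite divr_gt0.
move=> x y [[Yy By] nXy] hx; have Xx := hx.1.
have xy : x != y by apply/eqP => xy; apply: nXy; rewrite -xy.
have [xr1 xr2] := subr _ (proj_near hx XZ By).
have [yr1 yr2] : ball Z r1 y /\ ball Z r2 y.
  by apply/subr/(le_ball _ By); lra.
have nxy := nearest_point_normal hE hx.
have N0 : normal ip Y y !=set0 by exists 0; exact: normal0.
(* If x is in [Y], then x - y is a secant of [Y] and <n, u> is at most |n|/2. Hence |n - u|^2 is at
   least |n|^2 - |n| + 1, which exceeds 1/4. *)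
have [Yx|nYx] := pselect (Y x).
  apply: (@le_trans _ _ 2^-1); first by rewrite ge_min lexx orbT.
  apply: le_dist => // n hn; set u := unit_dir x y.
  have u1 : `|u| = 1 by exact: norm_unit_dir.
  have nu : `|ip n u| <= 2^-1 * `|n|.
    rewrite ipZr normrM normfV normr_id mulrC ler_pdivrMr ?normr_gt0 ?subr_eq0//.
    exact: hr2.
  rewrite -(@ler_pXn2r _ 2)// ?nnegrE// -(ip_norm hE) ipBl !ipBr (ipC u n).
  rewrite !(ip_norm hE) u1; move: nu; rewrite ler_norml => /andP[_ nu].
  have : 0 <= (`|n| - 2^-1) ^+ 2 by exact: sqr_ge0.
  lra.
apply: (@le_trans _ _ k); first by rewrite ge_min lexx.
have /= := hIT x y (conj Xx nYx) (conj Yy nXy) (hr1 _ xr1) (hr1 _ yr1).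
rewrite le_max => /orP[//|] hk.
(* As x - y is normal to [X] at x, so is -u; thus u lies in the negated cone, against 0 < k. *)
have : dist (unit_dir x y) (-%R @` normal ip X x) <= 0.
  rewrite -(normr0 E) -(subrr (unit_dir x y)); apply: dist_le.
  exists (- unit_dir x y); last by rewrite opprK.
  by rewrite -scaleNr; exact: normalZ.
lra.
Qed.

(* Pairing [v := x' - x = (x' - y) + (n - (x - y)) - n] with itself: both normals
   [x' - y] (at [x']) and [n] (at [x]) are almost orthogonal to the secant [v]. *)
Lemma secant_bound x y x' n (delta kappa : R) :
  0 <= delta -> 0 <= kappa ->
  `|x' - y| <= `|x - y| -> `|n - (x - y)| <= kappa * `|x - y| ->
  `|ip (x' - y) (x' - x)| <= delta * `|x' - y| * `|x' - x| ->
  `|ip n (x' - x)| <= delta * `|n| * `|x' - x| ->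
  `|x' - x| <= (delta * (2 + kappa) + kappa) * `|x - y|.
Proof.
move=> d0 k0 hx' hn hw hnv.
have [->|vn0] := eqVneq x' x.
  by rewrite subrr normr0 mulr_ge0// addr_ge0// mulr_ge0// addr_ge0.
have v0 : 0 < `|x' - x| by rewrite normr_gt0 subr_eq0.
have nle : `|n| <= (1 + kappa) * `|x - y|.
  have -> : n = (x - y) + (n - (x - y)) by rewrite addrC subrK.
  by rewrite (le_trans (ler_normD _ _))// mulrDl mul1r lerD2l.
have vE : x' - x = (x' - y) + (n - (x - y)) - n.
  by rewrite -[RHS]addrA [n - _ - n]addrAC subrr add0r opprB addrA subrK.
(* The three terms of [vE] contribute [delta], [kappa] and [delta * (1 + kappa)], each times |x - y|
   |x' - x|. *)
rewrite -(ler_pM2r v0) -expr2 -(ip_norm hE) [X in ip X _]vE ipBl ipDl.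
have c := cauchy_schwarz hE (n - (x - y)) (x' - x).
move: hw hnv c; rewrite !ler_norml => /andP[_ hw] /andP[hnv _] /andP[_ c].
have c' : `|n - (x - y)| * `|x' - x| <= kappa * `|x - y| * `|x' - x|.
  by rewrite ler_pM2r.
have hw' : delta * `|x' - y| * `|x' - x| <= delta * `|x - y| * `|x' - x|.
  by rewrite ler_pM2r// ler_wpM2l.
have hn' : delta * `|n| * `|x' - x| <= delta * ((1 + kappa) * `|x - y|) * `|x' - x|.
  by rewrite ler_pM2r// ler_wpM2l.
lra.
Qed.

Lemma half_projection_intrinsic X Y Z kappa (B : set E) :
  embedded_submanifold 2 X -> (X `&` Y) Z -> 0 < kappa <= 1 -> nbhs Z B ->
  half_projection_transversal X Y kappa B -> intrinsically_transversal ip X Y Z.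
Proof.
move=> hX [XZ YZ] /andP[k0 k1] /nbhs_ballP[r1 /= r10 hr1] hPT.
(* With closeness kappa/8, this value makes the bound of [secant_bound] at most (kappa/4) |x -
   y|. *)
have d0 : 0 < kappa / 32 by lra.
have [r2 r20 hr2] := normal_almost_orthogonal_secant hE hX XZ d0.
have [r3 r30 hr3] := proj_nonempty hE hX XZ.
pose r := Num.min r1 (Num.min r2 r3); have r0 : 0 < r by rewrite !lt_min r10 r20.
have subr x : ball Z r x -> [/\ ball Z r1 x, ball Z r2 x & ball Z r3 x].
  by split; apply: le_ball H; rewrite /r !ge_min lexx ?orbT.
(* The final error is (kappa/8 + kappa/4) |x - y|, while |x' - y| is at least (3/4) |x - y|, so
   after normalization it is at most kappa/2. Radius r/2 keeps the projection x' in the ball of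
   radius r. *)
exists (kappa / 8), (ball Z (r / 2)); split; [lra|lra|by apply: nbhsx_ballx; lra|].
move=> x y [Xx nYx] [Yy nXy] Bx By /=; set u := unit_dir x y.
have rr : r / 2 <= r by lra.
have [_ xr2 _] := subr _ (le_ball rr Bx).
have [yr1 _ yr3] := subr _ (le_ball rr By).
have [x' hx'] := hr3 _ yr3; have Xx' := hx'.1.
have [_ x'r2 _] := subr _ (proj_near hx' XZ By).
(* Failure of the bound yields [m] normal to [Y] at y and [m'] normal to [X] at x, with both m and
   -m' within kappa/8 of u. *)
rewrite leNgt gt_max; apply/negP => /andP[].
move=> /dist_lt[|m hm mu]; first by exists 0; exact: normal0.
move=> /dist_lt[|_ [m' hm' <-] m'u].
  by exists (- 0), 0 => //; exact: normal0.
have xy : x != y by apply/eqP => xy; apply: nXy; rewrite -xy.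
have D0 : 0 < `|x - y| by rewrite normr_gt0 subr_eq0.
have uE : x - y = `|x - y| *: u by rewrite scalerA divff ?scale1r// gt_eqF.
have scale_close q : `|q - u| < kappa / 8 ->
    `| `|x - y| *: q - (x - y)| <= kappa / 8 * `|x - y|.
  move=> /ltW qu; rewrite [X in _ - X]uE -scalerBr normrZ normr_id mulrC.
  by rewrite ler_pM2r.
have x'x : `|x' - x| <= (kappa / 32 * (2 + kappa / 8) + kappa / 8) * `|x - y|.
  apply: (@secant_bound _ _ _ (`|x - y| *: - m')) => //; [lra|lra| | | |].
  - exact: proj_min hx' Xx.
  - exact: scale_close.
  - have := hr2 _ _ _ Xx Xx' xr2 x'r2 (nearest_point_normal hE hx').
    by rewrite -[x - x']opprB ipNr !normrN.
  - by apply: hr2 => //; rewrite scalerN -scaleNr; exact: normalZ.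
have D'ge : `|x - y| - `|x' - x| <= `|x' - y|.
  rewrite lerBlDr; have -> : x - y = (x' - y) - (x' - x).
    by rewrite opprB [RHS]addrC addrA subrK.
  exact: ler_normB.
have c4 : kappa / 32 * (2 + kappa / 8) + kappa / 8 <= kappa / 4.
  have : kappa * kappa <= 1 * kappa by rewrite ler_pM2r.
  lra.
have x'x4 : `|x' - x| <= kappa / 4 * `|x - y|.
  by rewrite (le_trans x'x)// ler_pM2r.
have kD : kappa * `|x - y| <= `|x - y| by rewrite ger_pMl.
have D'0 : 0 < `|x' - y| by lra.
have := hPT x' y (conj (conj Yy (hr1 _ yr1)) nXy) hx'; apply/negP; rewrite -ltNge.
(* Rescaling [m] gives a normal to [Y] at y close to the direction of x' - y, contradicting the
   lower bound for the pair (x', y). *)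
pose q := `|x' - y|^-1 *: (`|x - y| *: m).
have Nq : normal ip Y y q by do 2! apply: normalZ.
apply: le_lt_trans (dist_le _ Nq) _.
rewrite /q /unit_dir -scalerBr normrZ normfV normr_id mulrC ltr_pdivrMr//.
have -> : `|x - y| *: m - (x' - y) = (`|x - y| *: m - (x - y)) - (x' - x).
  by rewrite -addrA -opprD; congr (_ - _); rewrite [RHS]addrC subrKA.
apply: le_lt_trans (ler_normB _ _) _.
have := scale_close _ mu.
have : kappa * (`|x - y| - `|x' - x|) <= kappa * `|x' - y| by rewrite ler_pM2l.
have : kappa * (kappa / 4 * `|x - y|) <= kappa / 4 * `|x - y|.
  by rewrite ger_pMl// mulr_gt0//; lra.
have : 0 < kappa * `|x - y| by rewrite mulr_gt0.
have : kappa * `|x' - x| <= kappa * (kappa / 4 * `|x - y|) by rewrite ler_pM2l.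
lra.
Qed.

End Transversality.

Theorem theorem4p4 (R : realType) (E : normedModType R)
    (ip : {dot E for idfun}) (hE : euclidean ip)
    (X Y : set E)
    (hX : embedded_submanifold 2 X) (hY : embedded_submanifold 2 Y)
    (Z : E) (hZ : (X `&` Y) Z) :
  intrinsically_transversal ip X Y Z <-> projection_transversal ip X Y Z.
Proof.
rewrite projection_transversalP; split=> [h|[[k [B [k01 ZB h]]] _]].
  split; first exact: intrinsic_half_projection.
  apply: intrinsic_half_projection => //; first by case: hZ.
  exact: intrinsically_transversalC.
exact: half_projection_intrinsic h.
Qed.
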